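(* No randomized online algorithm for the Online Multi-Commodity Facility Location Problem with commodity set $S$ can achieve a competitive ratio better than $\Omega\left(\sqrt{|S|}\right)$, even on instances whose metric space consists of a single point. That is, there is an absolute constant $\kappa>0$ such that for every finite commodity set $S$ and every randomized online algorithm that is $c(|S|,n)$-competitive on single-point instances with commodity set $S$, one has $c(|S|,n)\ge \kappa\sqrt{|S|}$ for all sufficiently large $n$.
   Context: Online Multi-Commodity Facility Location Problem (OMFLP). An instance consists of a finite metric space with point set $M$ and distance $d$, a finite nonempty set $S$ of commodities, construction costs $f_m^\sigma\ge 0$ for all $m\in M$ and $\sigma\subseteq S$ (all known in advance), and a sequence of $n$ requests. Each request $r$ is located at a point of $M$ and demands a nonempty set $s_r\subseteq S$; $d(m,r)$ denotes the distance from $m\in M$ to the location of $r$. A solution opens facilities, each at a point $m\in M$ with a configuration $\sigma\subseteq S$ (the set of commodities it offers), at cost $f_m^\sigma$; several facilities may be opened at the same point. Each request $r$ is assigned to a set of open facilities that jointly offer all commodities of $s_r$, at assignment cost equal to the sum of the distances from $r$ to these facilities. The total cost is the sum of all construction and assignment costs. Requests are revealed one by one; on arrival a request must immediately be assigned, where the algorithm may first open new facilities; all decisions are irrevocable. Standing assumptions on the costs: subadditivity, $f_m^{a\cup b}\le f_m^a+f_m^b$ for all $m\in M$, $a,b\subseteq S$; and $f_m^\sigma/|\sigma|\ge f_m^S/|S|$ for all $m\in M$ and nonempty $\sigma\subseteq S$. Competitive ratio: a (randomized) online algorithm is $c(|S|,n)$-competitive if there is a constant $a$, independent of the instance, such that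 on every instance its (expected) cost is at most $c(|S|,n)\cdot \mathrm{OPT}+a$, where OPT is the optimal offline cost of the instance and $n$ its number of requests. *)

(* Defs.v *)
From HB Require Import structures.
From mathcomp Require Import all_boot all_order all_algebra.
From mathcomp Require Import all_classical all_reals all_analysis.

Set Implicit Arguments.
Unset Strict Implicit.
Unset Printing Implicit Defensive.

Import Order.TTheory GRing.Theory Num.Theory.
Import numFieldNormedType.Exports.

Local Open Scope classical_set_scope.
Local Open Scope ring_scope.

(* The part of an instance that is known in advance: everything except the
   request sequence. *)
Record omflp (R : realType) (S : finType) := Omflp {
  sites : metricType R ;
  sites_finite : finite_set [set: sites] ;
  fcost : sites -> {set S} -> R ;
  fcost_ge0 : forall m sigma, 0 <= fcost m sigma ;
  fcost_subadditive : forall m (a b : {set S}),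
    fcost m (a :|: b)%SET <= fcost m a + fcost m b ;
  fcost_per_commodity : forall m (sigma : {set S}), sigma != finset.set0 ->
    fcost m sigma / #|sigma|%:R >= fcost m [set: S]%SET / #|S|%:R
}.

Definition single_point (R : realType) (S : finType) (E : omflp R S) : Prop :=
  exists x : sites E, [set: sites E] = [set x].

Record request (R : realType) (S : finType) (E : omflp R S) := Request {
  location : sites E ;
  demand : {set S} ;
  demand_neq0 : demand != finset.set0
}.

Section Facilities.
Context (R : realType) (S : finType) (E : omflp R S).

Definition facility : Type := (sites E * {set S})%type.

(* A list, so that the same facility may be opened several times. *)
Implicit Type F : seq facility.

Definition facility_at F (j : 'I_(size F)) : facility := tnth (in_tuple F) j.

Definition construction_cost F : R := \sum_(f <- F) fcost f.1 f.2.

Definition serves F (J : {set 'I_(size F)}) (r : request E) : Prop :=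
  demand r \subset (\bigcup_(j in J) (facility_at j).2)%SET.

Definition assignment_cost F (J : {set 'I_(size F)}) (r : request E) : R :=
  \sum_(j in J) mdist (facility_at j).1 (location r).

End Facilities.

Section Offline.
Context (R : realType) (S : finType) (E : omflp R S).

Record offline_solution (rs : seq (request E)) := OfflineSolution {
  facilities : seq (facility E) ;
  assignment : 'I_(size rs) -> {set 'I_(size facilities)} ;
  assignment_serves : forall i : 'I_(size rs),
    serves (assignment i) (tnth (in_tuple rs) i)
}.

Definition offline_cost (rs : seq (request E)) (s : offline_solution rs) : R :=
  construction_cost (facilities s) +
  \sum_(i < size rs) assignment_cost (assignment s i) (tnth (in_tuple rs) i).

Definition OPT (rs : seq (request E)) : R :=
  inf (range (@offline_cost rs)).

End Offline.

Section Online.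
Context (R : realType) (S : finType) (E : omflp R S).

(* Facilities open after the history rs, when opens h lists the facilities
   opened on arrival of the last request of the history h. *)
Definition opened (opens : seq (request E) -> seq (facility E))
    (rs : seq (request E)) : seq (facility E) :=
  flatten [seq opens (take t.+1 rs) | t <- iota 0 (size rs)].

(* Decisions at a request are functions of the requests revealed so far, that
   request included.  Irrevocability is built in: the list of open facilities
   only grows at its end, and the last request of a history h is assigned once
   and for all, to positions in the list of facilities open at that time.
   The value of assigns at the empty history is irrelevant. *)
Record online_run := OnlineRun {
  opens : seq (request E) -> seq (facility E) ;
  assigns : forall h : seq (request E), {set 'I_(size (opened opens h))} ;
  assigns_serves : forall (h : seq (request E)) (r : request E),
    serves (assigns (rcons h r)) r
}.

Definition online_cost (A : online_run) (rs : seq (request E)) : R :=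
  construction_cost (opened (opens A) rs) +
  \sum_(t < size rs)
     assignment_cost (assigns A (take t.+1 rs)) (tnth (in_tuple rs) t).

End Online.

Definition deterministic_algorithm (R : realType) (S : finType) : Type :=
  forall E : omflp R S, online_run E.

(* A random deterministic algorithm.  Measurability is required only of the
   cost on each instance, which is what the expected cost needs. *)
Record randomized_algorithm (R : realType) (S : finType) := RandomizedAlgorithm {
  coin_display : measure_display ;
  coin : measurableType coin_display ;
  coin_prob : probability coin R ;
  algorithm : coin -> deterministic_algorithm R S ;
  measurable_cost : forall (E : omflp R S) (rs : seq (request E)),
    measurable_fun [set: coin] (fun w => online_cost (algorithm w E) rs)
}.

Arguments algorithm {R S} _ _ _.

Definition expected_cost (R : realType) (S : finType)
    (A : randomized_algorithm R S) (E : omflp R S) (rs : seq (request E)) :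
    \bar R :=
  'E_(coin_prob A)[fun w => online_cost (algorithm A w E) rs]%E.

(* c(|S|, n)-competitiveness on the instances satisfying D. *)
Definition competitive_on (R : realType) (S : finType)
    (D : omflp R S -> Prop) (c : nat -> nat -> R)
    (A : randomized_algorithm R S) : Prop :=
  exists a : R, forall E : omflp R S, D E -> forall rs : seq (request E),
    (expected_cost A rs <= (c #|S| (size rs) * OPT rs + a)%:E)%E.

(* Main.v *)
(* Yao's principle on a single point, with costs L (k + |sigma|), where k is the
   integer part of sqrt |S|: the requests are k independent uniformly random
   commodities, followed by repetitions of a fixed commodity that pad the
   sequence to length n.  One facility offering all requested commodities costs
   at most 3kL.  If the facilities of an online algorithm end up with expected
   total configuration size x, each random request is uncovered with
   probability at least 1 - x / |S| and then forces a new facility, so the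
   expected cost is at least L (k * k (1 - x / |S|) + x) >= L k^2, as
   k^2 <= |S|.  Letting L grow makes the additive constant irrelevant. *)
Require Import Defs.
From HB Require Import structures.
From mathcomp Require Import all_boot all_order all_algebra.
From mathcomp Require Import all_classical all_reals all_analysis.
From mathcomp Require Import measurable_realfun zify ring lra.

Set Implicit Arguments.
Unset Strict Implicit.
Unset Printing Implicit Defensive.

Import Order.TTheory GRing.Theory Num.Theory.
Import numFieldNormedType.Exports.

Local Open Scope ring_scope.

(** * General facts on opened facilities, costs, the optimum and expected cost *)

Section Costs.
Context (R : realType) (S : finType) (E : omflp R S).
Implicit Types (F : seq (facility E)) (rs h : seq (request E)).

Lemma construction_cost_ge0 F : 0 <= construction_cost F.
Proof. by apply: sumr_ge0 => f _; exact: fcost_ge0. Qed.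

Lemma construction_cost_cat F1 F2 :
  construction_cost (F1 ++ F2) = construction_cost F1 + construction_cost F2.
Proof. by rewrite /construction_cost big_cat. Qed.

Lemma assignment_cost_ge0 F (J : {set 'I_(size F)}) (r : request E) :
  0 <= assignment_cost J r.
Proof. by apply: sumr_ge0 => j _; exact: mdist_ge0. Qed.

Lemma offline_cost_ge0 rs (s : offline_solution rs) : 0 <= offline_cost s.
Proof.
rewrite addr_ge0 ?construction_cost_ge0 ?sumr_ge0// => i _.
exact: assignment_cost_ge0.
Qed.

Lemma OPT_le rs (s : offline_solution rs) : OPT rs <= offline_cost s.
Proof.
apply: ge_inf; last by exists s.
by exists 0 => _ [t _ <-]; exact: offline_cost_ge0.
Qed.

Lemma OPT_ge0 rs (s : offline_solution rs) : 0 <= OPT rs.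
Proof.
apply: lb_le_inf; first by exists (offline_cost s), s.
by move=> _ [t _ <-]; exact: offline_cost_ge0.
Qed.

Lemma opened_rcons (o : seq (request E) -> seq (facility E)) h r :
  opened o (rcons h r) = opened o h ++ o (rcons h r).
Proof.
rewrite /opened size_rcons -addn1 iotaD map_cat flatten_cat /= cats0 add0n.
congr (flatten _ ++ o _); last by rewrite -(size_rcons h r) take_size.
apply/eq_in_map => t; rewrite mem_iota => /andP[_ th].
by rewrite -cats1 takel_cat.
Qed.

Lemma construction_cost_opened_cat (o : seq (request E) -> seq (facility E))
    h1 h2 :
  construction_cost (opened o h1) <= construction_cost (opened o (h1 ++ h2)).
Proof.
elim/last_ind: h2 => [|h2 r IH]; first by rewrite cats0.
rewrite -rcons_cat opened_rcons construction_cost_cat (le_trans IH)//.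
by rewrite lerDl construction_cost_ge0.
Qed.

Lemma construction_cost_le_online_cost (A : online_run E) rs :
  construction_cost (opened (opens A) rs) <= online_cost A rs.
Proof. by rewrite lerDl sumr_ge0// => t _; exact: assignment_cost_ge0. Qed.

Lemma online_cost_ge0 (A : online_run E) rs : 0 <= online_cost A rs.
Proof.
exact: le_trans (construction_cost_ge0 _) (construction_cost_le_online_cost A _).
Qed.

Lemma serves_demand F (J : {set 'I_(size F)}) (r : request E) e :
  serves J r -> e \in demand r -> exists2 f, f \in F & e \in f.2.
Proof.
move=> /fintype.subsetP sJ /sJ /finset.bigcupP[j _ ej].
by exists (facility_at j) => //; exact: mem_tnth.
Qed.

(** The averaging half of Yao's principle: the finite sum over request sequences moves inside the
    integral over the coin, where the bound holds pointwise, and a constant integrates to itself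
    against a probability. *)
Lemma expected_cost_sum_ge (A : randomized_algorithm R S)
    (rss : seq (seq (request E))) (b : R) : 0 <= b ->
  (forall w, b <= \sum_(rs <- rss) online_cost (algorithm A w E) rs) ->
  (b%:E <= \sum_(rs <- rss) expected_cost A rs)%E.
Proof.
move=> b0 le_b.
rewrite /expected_cost; under eq_bigr do rewrite unlock.
rewrite -ge0_integral_sum//; first last.
- by move=> rs w _; rewrite lee_fin online_cost_ge0.
- by move=> rs; apply/measurable_EFinP; exact: measurable_cost.
have <- : (\int[coin_prob A]_w b%:E = b%:E)%E.
  by rewrite integral_cst// [X in (_ * X)%E]probability_setT mule1.
apply: ge0_le_integral => //.
- apply: emeasurable_sum => rs; apply/measurable_EFinP.
  exact: measurable_cost.
- by move=> w _; rewrite sumEFin lee_fin.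
Qed.

End Costs.

(* The parameter R only serves to infer the R-valued metric. *)
Definition one_point (R : realType) : Type := unit.

(** * The single-point instances with affine costs *)

Section OnePoint.
Context (R : realType).

HB.instance Definition _ := Choice.on (one_point R).

Let dist0 (x y : one_point R) : R := 0.

Let dist0xx x : dist0 x x = 0. Proof. by []. Qed.

Let dist0_eq x y : dist0 x y = 0 -> x = y. Proof. by case: x y => [] []. Qed.

Let dist0_sym x y : dist0 x y = dist0 y x. Proof. by []. Qed.

Let dist0_triangle y x z : dist0 x z <= dist0 x y + dist0 y z.
Proof. by rewrite addr0. Qed.

HB.instance Definition _ :=
  isMetric.Build R (one_point R) dist0xx dist0_eq dist0_sym dist0_triangle.

End OnePoint.

Section AffineCost.
Context (R : realType) (S : finType) (L q : R).
Hypotheses (L_ge0 : 0 <= L) (q_ge0 : 0 <= q).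

Definition affine_cost (_ : one_point R) (s : {set S}) : R :=
  L * (q + #|s|%:R).

Let affine_cost_ge0 m s : 0 <= affine_cost m s.
Proof. by rewrite mulr_ge0// addr_ge0. Qed.

Let affine_cost_subadditive m (a b : {set S}) :
  affine_cost m (a :|: b)%SET <= affine_cost m a + affine_cost m b.
Proof.
rewrite -mulrDr ler_wpM2l//.
have : (#|(a :|: b)%SET|%:R <= #|a|%:R + #|b|%:R :> R).
  by rewrite -natrD ler_nat cardsU leq_subr.
move: q_ge0 => q0 cardU; lra.
Qed.

Let affine_cost_per_commodity m (s : {set S}) : s != finset.set0 ->
  affine_cost m s / #|s|%:R >= affine_cost m [set: S]%SET / #|S|%:R.
Proof.
rewrite -card_gt0 => s0.
have sS : (#|s| <= #|S|)%N by exact: max_card.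
have S0 := leq_trans s0 sS.
(* The cost per commodity is [L * (q / #|s| + 1)], which decreases as [#|s|] grows. *)
rewrite /affine_cost cardsT -!mulrA ler_wpM2l// !mulrDl.
rewrite !divff ?pnatr_eq0 -?lt0n// lerD2r ler_wpM2l//.
by rewrite lef_pV2 ?posrE ?ltr0n// ler_nat.
Qed.

Let one_point_finite : finite_set [set: one_point R].
Proof.
apply: (@sub_finite_set _ _ [set tt]%classic); first by case.
exact: finite_set1.
Qed.

Definition affine_omflp : omflp R S :=
  Omflp one_point_finite affine_cost_ge0 affine_cost_subadditive
    affine_cost_per_commodity.

Lemma affine_omflp_single_point : single_point affine_omflp.
Proof. by exists tt; apply/seteqP; split=> // -[]. Qed.

Lemma set1_neq0 (e : S) : [set e]%SET != finset.set0.
Proof. by apply/finset.set0Pn; exists e; rewrite finset.in_set1. Qed.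

Definition request1 (e : S) : request affine_omflp :=
  @Request R S affine_omflp tt [set e]%SET (set1_neq0 e).

(** One facility with configuration [s] serves every request, at distance 0. *)
Lemma affine_OPT (rs : seq (request affine_omflp)) (s : {set S}) :
  all (fun r => demand r \subset s) rs ->
  0 <= OPT rs <= L * (q + #|s|%:R).
Proof.
move=> rs_s.
pose F : seq (facility affine_omflp) := [:: (tt : sites affine_omflp, s)].
have served (i : 'I_(size rs)) :
    @serves R S affine_omflp F [set: _]%SET (tnth (in_tuple rs) i).
  rewrite /serves; apply: (@fintype.subset_trans _ _ s).
    exact: (elimT (@all_tnthP _ _ _ (in_tuple rs)) rs_s i).
  by apply: (@finset.bigcup_max _ _ (@ord0 0)).
pose sol := OfflineSolution served.
have -> : L * (q + #|s|%:R) = offline_cost sol.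
  rewrite /offline_cost /construction_cost big_seq1 /= big1 ?addr0//.
  move=> i _; apply: big1 => j _.
  case: (facility_at j) => -[] t; case: (location _).
  by rewrite metric_structure.mdistxx.
by rewrite (OPT_ge0 sol) OPT_le.
Qed.


Definition total_size (F : seq (facility affine_omflp)) : R :=
  \sum_(f <- F) #|f.2|%:R.

Lemma affine_construction_cost F :
  construction_cost F = L * (q * (size F)%:R + total_size F).
Proof.
rewrite /construction_cost -mulr_sumr big_split/=; congr (_ * (_ + _)).
by rewrite big_const_seq count_predT iter_addr_0 mulr_natr.
Qed.

Lemma total_size_cat F1 F2 :
  total_size (F1 ++ F2) = total_size F1 + total_size F2.
Proof. by rewrite /total_size big_cat. Qed.

Lemma total_size_ge0 F : 0 <= total_size F.
Proof. by apply: sumr_ge0. Qed.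

(* A uniformly random commodity is offered by F with probability at most
   total_size F / #|S|, and otherwise a new facility must be opened. *)
Lemma sum_size_opened_rcons (A : online_run affine_omflp) h :
  #|S|%:R * ((size (opened (opens A) h))%:R + 1) - total_size (opened (opens A) h)
  <= \sum_(e : S) (size (opened (opens A) (rcons h (request1 e))))%:R.
Proof.
set F := opened _ h.
(* Double counting of the pairs of a commodity and a facility of [F] offering it. *)
have -> : total_size F = \sum_(e : S) \sum_(f <- F) (e \in f.2)%:R.
  rewrite exchange_big; apply: eq_bigr => f _.
  by rewrite -natr_sum -sum1_card big_mkcond.
have -> : #|S|%:R * ((size F)%:R + 1) = \sum_(e : S) ((size F)%:R + 1) :> R.
  by rewrite sumr_const mulr_natl.
rewrite -sumrB; apply: ler_sum => e _.
rewrite opened_rcons size_cat natrD -addrA lerD2l -/F.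
have := assigns_serves A h (request1 e).
move=> /serves_demand -/(_ e); rewrite finset.in_set1 eqxx => /(_ isT)[f].
rewrite opened_rcons mem_cat => /orP[fF|fo] ef.
  (* If a facility of [F] already offers [e], the left side is at most 0. Otherwise [f] is newly
     opened, and the list of new facilities has length at least 1. *)
  apply: (@le_trans _ _ 0) => //; rewrite subr_le0 (big_rem f)//= ef.
  by rewrite lerDl sumr_ge0.
apply: (@le_trans _ _ 1).
  by rewrite lerBlDr lerDl sumr_ge0.
by rewrite ler1n; case: (opens A _) fo.
Qed.

End AffineCost.

(** * Sums over all words of length [j], the sample space of the uniform random requests *)

Fixpoint words (S : finType) (j : nat) : seq (seq S) :=
  if j is i.+1 then [seq e :: w | e <- enum S, w <- words S i] else [:: [::]].

Lemma size_words (S : finType) (j : nat) :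
  size (words S j) = (#|S| ^ j)%N.
Proof. by elim: j => // j IH; rewrite size_allpairs IH cardE expnS. Qed.

Lemma words_size (S : finType) (j : nat) w :
  w \in words S j -> size w = j.
Proof.
elim: j w => [|j IH] w /=; first by rewrite inE => /eqP ->.
by move=> /allpairsP[[e v] /= [_ /IH <- ->]].
Qed.

Section LowerBound.
Context (R : realType) (S : finType) (L q : R).
Hypotheses (L_ge0 : 0 <= L) (q_ge0 : 0 <= q) (S_gt0 : (0 < #|S|)%N).
Let E := affine_omflp S L_ge0 q_ge0.
Let req : S -> request E := request1 L_ge0 q_ge0.

(* Backward induction on the number j of remaining requests; j q <= #|S| makes
   the bound nondecreasing in total_size. *)
Lemma sum_words_construction_cost (A : online_run E) (j : nat)
    (h : seq (request E)) : j%:R * q <= #|S|%:R ->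
  #|S|%:R ^+ j * (L * (q * (size (opened (opens A) h))%:R +
      j%:R * q * (1 - total_size (opened (opens A) h) / #|S|%:R) +
      total_size (opened (opens A) h)))
  <= \sum_(w <- words S j) construction_cost (opened (opens A) (h ++ map req w)).
Proof.
have N0 : 0 < #|S|%:R :> R by rewrite ltr0n.
elim: j h => [|j IH] h jq.
  rewrite big_seq1 cats0 affine_construction_cost expr0 mul1r.
  by rewrite !mul0r addr0.
have jq' : j%:R * q <= #|S|%:R.
  by apply: le_trans jq; rewrite ler_wpM2r// ler_nat.
rewrite big_allpairs_dep /= big_enum /=.
set x := total_size (opened _ h); set m := size (opened _ h).
pose n e := (size (opened (opens A) (rcons h (req e))))%:R : R.
have step e : #|S|%:R ^+ j * (L * (q * n e + j%:R * q * (1 - x / #|S|%:R) + x))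
    <= \sum_(w <- words S j)
         construction_cost (opened (opens A) (h ++ map req (e :: w))).
  under eq_bigr do rewrite /= -cat_rcons.
  apply: le_trans (IH _ jq'); rewrite ler_wpM2l ?exprn_ge0// ler_wpM2l//.
  rewrite -/(n e); set y := total_size _.
  have xy : x <= y.
    by rewrite /y opened_rcons total_size_cat lerDl total_size_ge0.
  have : 0 <= (1 - j%:R * q / #|S|%:R) * (y - x).
    by rewrite mulr_ge0 ?subr_ge0// ler_pdivrMr// mul1r.
  lra.
apply: le_trans (ler_sum _ (fun e _ => step e)).
rewrite -mulr_sumr -mulr_sumr exprSr -mulrA ler_wpM2l ?exprn_ge0//.
rewrite mulrCA ler_wpM2l//.
have -> : \sum_(e : S) (q * n e + j%:R * q * (1 - x / #|S|%:R) + x) =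
    q * (\sum_(e : S) n e) + #|S|%:R * (j%:R * q * (1 - x / #|S|%:R)) +
    #|S|%:R * x.
  by rewrite 2!big_split /= -mulr_sumr 2!sumr_const !(mulr_natl _ #|S|).
have := sum_size_opened_rcons A h; rewrite -/x -/m => /(ler_wpM2l q_ge0).
rewrite -/n => le_sum.
(* One of the [j.+1] terms [q * (1 - x / #|S|)] is split off and joined with [q * m]; this forms
   exactly the quantity bounded in [le_sum]. *)
have -> : #|S|%:R * (q * m%:R + j.+1%:R * q * (1 - x / #|S|%:R) + x) =
   q * (#|S|%:R * (m%:R + 1) - x) + #|S|%:R * (j%:R * q * (1 - x / #|S|%:R)) +
   #|S|%:R * x.
  by rewrite -natr1; field; rewrite gt_eqF.
lra.
Qed.

End LowerBound.

(** * Choice of the parameters and the final contradiction *)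

Lemma nat_sqrt_ex (n : nat) : exists k : nat, (k * k <= n < k.+1 * k.+1)%N.
Proof.
elim: n => [|n [k /andP[kn nk]]]; first by exists 0%N.
have [le|lt] := leqP (k.+1 * k.+1) n.+1; last by exists k; apply/andP; lia.
by exists k.+1; apply/andP; nia.
Qed.

Theorem theorem2 (R : realType) :
  exists2 kappa : R, 0 < kappa &
    forall S : finType, (0 < #|S|)%N ->
    forall (A : randomized_algorithm R S) (c : nat -> nat -> R),
      competitive_on (@single_point R S) c A ->
      exists N : nat, forall n : nat, (N <= n)%N ->
        kappa * Num.sqrt (#|S|%:R) <= c #|S| n.
Proof.
(* A factor 3 is lost in bounding the optimum by [3 * k * L], and a factor 2 in replacing the root
   of [#|S|] by [k]. *)
exists (1 / 6); first by lra.
move=> S S_gt0 A c [a competitive].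
have [k /andP[kS Sk]] := nat_sqrt_ex #|S|.
have k_gt0 : (0 < k)%N by rewrite lt0n; apply/eqP => k0; lia.
have /card_gt0P[e0 _] := S_gt0.
(* The [k] random requests must fit into a sequence of length [n]. *)
exists k => n kn.
(* Since [k] is positive, [#|S| < k.+1 ^ 2 <= (2 * k) ^ 2]. *)
have sqrtS : Num.sqrt (#|S|%:R) <= 2 * k%:R :> R.
  rewrite -(@ger0_norm R (2 * k%:R)) ?mulr_ge0// -sqrtr_sqr ler_sqrt ?sqr_ge0//.
  by rewrite -natrM -natrX ler_nat; nia.
suff : k%:R / 3 <= c #|S| n by lra.
rewrite leNgt; apply/negP => c_lt.
have kR_gt0 : 0 < k%:R :> R by rewrite ltr0n.
(* Truncation at 0 allows multiplying an upper bound on the optimum by the ratio, as [c] may be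
   negative. *)
pose g := Num.max (c #|S| n) 0.
have g_lt : g < k%:R / 3 by rewrite gt_max c_lt divr_gt0.
have g_ge0 : 0 <= g by rewrite le_max lexx orbT.
(* Per unit of [L], the lower bound [k * k] on the average online cost minus the bound [3 * k * g]
   that competitiveness gives up to [a]. *)
pose gap : R := k%:R * (k%:R - 3 * g).
have gap_gt0 : 0 < gap by rewrite mulr_gt0//; lra.
(* The scale of the costs is chosen to beat the additive constant a. *)
have [L L_ge0 Lgap] : exists2 L, 0 <= L & L * gap = `|a| + 1.
  exists ((`|a| + 1) / gap); first by rewrite divr_ge0 ?addr_ge0// ltW.
  by rewrite divfK// gt_eqF.
pose E := affine_omflp S L_ge0 (ler0n R k).
pose req : S -> request E := request1 L_ge0 (ler0n R k).
pose rs w := map req w ++ nseq (n - k) (req e0).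
have upper w : w \in words S k ->
    (expected_cost A (rs w) <= (3 * k%:R * L * g + a)%:E)%E.
  move=> /words_size sw.
  have size_rs : size (rs w) = n.
    by rewrite size_cat size_map size_nseq sw subnKC.
  have := competitive E (affine_omflp_single_point _ _ _) (rs w).
  move=> /le_trans; apply; rewrite lee_fin size_rs lerD2r.
  have /andP[OPT0 OPT_le] : 0 <= OPT (rs w) <=
      L * (k%:R + #|[set e in e0 :: w]%SET|%:R).
    apply: affine_OPT; rewrite all_cat all_nseq all_map; apply/andP; split.
      apply/allP => e ew /=.
      by rewrite finset.sub1set finset.inE in_cons ew orbT.
    by rewrite /= finset.sub1set finset.inE in_cons eqxx orbT.
  (* The letters of [w] and the padding commodity make at most [k + 1 <= 2 * k] commodities. *)
  have card_w : #|[set e in e0 :: w]%SET|%:R <= 2 * k%:R :> R.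
    rewrite -natrM ler_nat cardsE (leq_trans (card_size _))//= sw; lia.
  apply: (@le_trans _ _ (g * OPT (rs w))).
    by rewrite ler_wpM2r// le_max lexx.
  rewrite mulrC ler_wpM2r// (le_trans OPT_le)//.
  rewrite [3 * _ * _]mulrC ler_wpM2l//; lra.
have N_gt0 : 0 < #|S|%:R ^+ k :> R by rewrite exprn_gt0// ltr0n.
have lower : ((#|S|%:R ^+ k * (L * (k%:R * k%:R)))%:E <=
    \sum_(w <- words S k) expected_cost A (rs w))%E.
  rewrite -(big_map rs xpredT (fun r => expected_cost A r)).
  apply: expected_cost_sum_ge; first by rewrite !mulr_ge0.
  move=> w; rewrite big_map.
  have := @sum_words_construction_cost R S L k%:R L_ge0 (ler0n R k) S_gt0
    (algorithm A w E) k [::].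
  rewrite -natrM ler_nat => /(_ kS).
  (* No facility is open at the empty history, so the bound becomes [L * (k * k)]. *)
  rewrite /opened /= /total_size big_nil !(mulr0, mul0r, subr0, add0r, addr0).
  rewrite mulr1 natrM => /le_trans; apply; apply: ler_sum => v _.
  (* Assignment costs and facilities opened during the padding only add to the cost. *)
  apply: le_trans (construction_cost_le_online_cost _ _).
  exact: construction_cost_opened_cat.
have : (\sum_(w <- words S k) expected_cost A (rs w) <=
    (#|S|%:R ^+ k * (3 * k%:R * L * g + a))%:E)%E.
  rewrite big_seq; apply: (le_trans (lee_sum _ upper)).
  rewrite -big_seq sumEFin lee_fin big_const_seq count_predT iter_addr_0.
  by rewrite size_words -natrX -[leLHS]mulr_natl.
move=> /(le_trans lower); rewrite lee_fin ler_pM2l// => le_a.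
have := ler_norm a.
have : L * gap <= a by rewrite /gap; lra.
rewrite Lgap; lra.
Qed.
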